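(* Let $I$ be a set. Let $\{(G_i,\|\cdot\|_i,p_i)\}_{i\in I}$ be a collection of groups $G_i$ together with integer valued norms $\|\cdot\|_i$ and maps $p_i:G_i\to G_i$ which satisfy for all $i\in I$ (i) $d_i(p_i(g),p_i(h))\le d_i(g,h)$ for all $g,h\in G_i$; (ii) $d_i(p_i(g),g)\le1$ for all $g\in G_i$; (iii) $\|p_i(g)\|_i<\|g\|_i$ for all non-trivial $g\in G_i$; (iv) $p_i(1)=1$, where $1\in G_i$ is the trivial element; where $d_i(g,h)=\|gh^{-1}\|_i$ denotes the metric induced by $\|\cdot\|_i$. Then all asymptotic cones of the free product $G=\ast_{i\in I}G_i$ with respect to the $\ell_1$-norm associated to the collection $\{(G_i,\|\cdot\|_i)\}_{i\in I}$ are contractible (for every non-principal ultrafilter on $\mathbb{N}$ and every scaling sequence).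
   Context: A norm on a group $G$ is $\|\cdot\|:G\to[0,\infty)$ with $\|g\|=0$ iff $g=1$, $\|gh\|\le\|g\|+\|h\|$ and $\|g^{-1}\|=\|g\|$ (so that $d(g,h)=\|gh^{-1}\|$ is a metric); norms here are not assumed conjugation invariant. Every $g\in\ast_{i\in I}G_i$ is uniquely a reduced word $g=g_1\cdots g_k$ with $1\neq g_j\in G_{i_j}$ and consecutive letters in different factors. The $\ell_1$-norm associated to $\{(G_i,\|\cdot\|_i)\}$ is $\|g\|_{\ell_1}=\|g_1\|_{i_1}+\dots+\|g_k\|_{i_k}$; it induces the metric $d(g,h)=\|gh^{-1}\|_{\ell_1}$. Given a non-principal ultrafilter $\omega$ on $\mathbb{N}$ and a scaling sequence, i.e. positive reals $(s_n)$ with $\lim_\omega s_n=\infty$, a sequence $(x_n)$ in $G$ is admissible if $\|x_n\|/s_n$ is bounded; the asymptotic cone $\mathrm{Cone}_\omega(G,s_n)$ is the metric space of admissible sequences modulo $\lim_\omega d(x_n,y_n)/s_n=0$, with metric $\lim_\omega d(x_n,y_n)/s_n$. *)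

(* Defs.v *)
From HB Require Import structures.
From mathcomp Require Import all_boot all_order all_algebra generic_quotient.
From mathcomp Require Import all_classical all_reals topology normedtype.

Set Implicit Arguments.
Unset Strict Implicit.
Unset Printing Implicit Defensive.

Import Order.TTheory GRing.Theory Num.Theory.
Import numFieldNormedType.Exports.

Local Open Scope classical_set_scope.
Local Open Scope ring_scope.

Record group_norm (R : realType) (G : groupType) := GroupNorm {
  gnorm :> G -> R ;
  gnorm_ge0 : forall g, 0 <= gnorm g ;
  gnorm_eq0 : forall g, gnorm g = 0 <-> g = 1%g ;
  gnormM : forall g h, gnorm (g * h)%g <= gnorm g + gnorm h ;
  gnormV : forall g, gnorm (g^-1)%g = gnorm g }.

(* Norms are not assumed conjugation invariant: this distance is right-invariant,
   but in general not left-invariant. *)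
Definition gdist (R : realType) (G : groupType) (N : group_norm R G) (g h : G) : R :=
  N (g * h^-1)%g.

Section GroupNormTheory.
Context (R : realType) (G : groupType) (N : group_norm R G).
Implicit Types g h k : G.

Lemma gdist_ge0 g h : 0 <= gdist N g h.
Proof. exact: gnorm_ge0. Qed.

Lemma gdistxx g : gdist N g g = 0.
Proof. by rewrite /gdist mulgV; apply/gnorm_eq0. Qed.

Lemma gdistC g h : gdist N g h = gdist N h g.
Proof. by rewrite /gdist -gnormV invgM invgK. Qed.

Lemma gdist_triangle h g k : gdist N g k <= gdist N g h + gdist N h k.
Proof.
by rewrite /gdist (_ : g * k^-1 = (g * h^-1) * (h * k^-1))%g ?gnormM// mulgA mulgVK.
Qed.

Lemma gdist_le g h : gdist N g h <= N g + N h.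
Proof. by rewrite /gdist (le_trans (gnormM _ _ _))// gnormV. Qed.

End GroupNormTheory.

Section FreeProduct.
Local Open Scope group_scope.
Context (I : choiceType) (G : I -> groupType).

Definition letter := {i : I & G i}.

Definition reduced (w : seq letter) : bool :=
  all (fun x : letter => tagged x != 1) w && sorted (fun x y : letter => tag x != tag y) w.

Record free_product := FreeProduct { word :> seq letter ; word_reduced : reduced word }.
HB.instance Definition _ := [isSub for word].
HB.instance Definition _ := [Choice of free_product by <:].

(* The reduced form of [x * w], for a letter [x] (possibly the neutral element of
   its factor) and a reduced word [w]. *)
Definition mul_letter (x : letter) (w : seq letter) : seq letter :=
  if tagged x == 1 then w else
  if w is y :: w' then
    if tag y == tag x then
      let g := tagged x * tagged_as x y in
      if g == 1 then w' else Tagged G g :: w'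
    else x :: w
  else [:: x].

Definition mul_word (v w : seq letter) : seq letter := foldr mul_letter w v.

Definition inv_letter (x : letter) : letter := Tagged G (tagged x)^-1.

Definition inv_word (w : seq letter) : seq letter := rev (map inv_letter w).

Lemma reduced_cons x w : reduced (x :: w) =
  [&& tagged x != 1, (if w is y :: _ then tag x != tag y else true) & reduced w].
Proof.
rewrite /reduced; case: w => [|y w] /=; first by rewrite !andbT.
by rewrite -!andbA; do !bool_congr.
Qed.

Lemma reduced_mul_letter x w : reduced w -> reduced (mul_letter x w).
Proof.
rewrite /mul_letter; case: eqP => // /eqP x1.
case: w => [|y w] rw; first by rewrite reduced_cons x1.
case: eqP => [e|/eqP ne]; last by rewrite reduced_cons x1 eq_sym ne.
move: rw; rewrite reduced_cons => /and3P[_ yw rw].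
case: eqP => // /eqP g1; rewrite reduced_cons rw g1 andbT /=.
by case: w yw {rw} => // z w; rewrite e.
Qed.

Lemma reduced_mul_word v w : reduced w -> reduced (mul_word v w).
Proof. by move=> rw; elim: v => //= x v; exact: reduced_mul_letter. Qed.

Lemma reduced_inv_word w : reduced w -> reduced (inv_word w).
Proof.
rewrite /reduced /inv_word all_rev rev_sorted => /andP[w1 ws].
rewrite all_map sorted_map; apply/andP; split.
  by apply: sub_all w1 => x /=; rewrite invg_eq1.
by rewrite (eq_sorted (e' := fun x y : letter => tag x != tag y))// => x y /=; rewrite eq_sym.
Qed.

Lemma mul_letter_cons x w : reduced (x :: w) -> mul_letter x w = x :: w.
Proof.
rewrite reduced_cons => /and3P[x1 xw _]; rewrite /mul_letter (negPf x1).
by case: w xw => // y w; rewrite eq_sym => /negPf ->.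
Qed.

Lemma mul_letter1 i w : mul_letter (Tagged G (1 : G i)) w = w.
Proof. by rewrite /mul_letter /= eqxx. Qed.

Lemma mul_letterM i (g h : G i) w : reduced w ->
  mul_letter (Tagged G g) (mul_letter (Tagged G h) w) = mul_letter (Tagged G (g * h)) w.
Proof.
move=> rw; have [->|h1] := eqVneq h 1; first by rewrite mul_letter1 mulg1.
have [->|g1] := eqVneq g 1; first by rewrite mul_letter1 mul1g.
case: w rw => [|[j k] w] rw.
  rewrite /mul_letter /= (negPf h1) (negPf g1) eqxx tagged_asE.
  by case: eqP.
rewrite {2}/mul_letter /= (negPf h1).
have [e|ne] := eqVneq j i; last first.
  rewrite /mul_letter /= (negPf g1) eqxx tagged_asE; case: eqP => // _.
  by rewrite (negPf ne).
subst j; rewrite [tagged_as _ _]tagged_asE.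
move: (rw); rewrite reduced_cons /= => /and3P[k1 iw rw'].
have w_ne x : x != 1 -> mul_letter (Tagged G (x : G i)) w = Tagged G x :: w.
  by move=> x1; apply: mul_letter_cons; rewrite reduced_cons /= x1 rw' andbT.
have [hk|hk] := eqVneq (h * k) 1.
  rewrite w_ne// /mul_letter /= eqxx tagged_asE -mulgA hk mulg1 (negPf g1).
  case: eqP => // gh; congr (Tagged G _ :: w).
  by rewrite -[k]mul1g -gh -mulgA hk mulg1.
rewrite {1}/mul_letter /= (negPf g1) eqxx tagged_asE.
rewrite /mul_letter /= eqxx tagged_asE -mulgA.
have [gh|//] := eqVneq (g * h) 1; rewrite mulgA gh mul1g (negPf k1).
by [].
Qed.

Lemma mul_wordA u v w : reduced v -> reduced w ->
  mul_word (mul_word u v) w = mul_word u (mul_word v w).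
Proof.
move=> rv rw; elim: u => //= x u <-.
have := reduced_mul_word u rv; move: (mul_word u v) => {u v rv} [|[j k] v] rv.
  by rewrite {1}/mul_letter; case: eqP => // x1; rewrite /mul_letter x1 eqxx.
case: x => i g; have [->|g1] := eqVneq g 1; first by rewrite !mul_letter1.
have [e|ne] := eqVneq j i; last first.
  by rewrite {1}/mul_letter /= (negPf g1) (negPf ne).
subst j; rewrite {1}/mul_letter /= (negPf g1) eqxx tagged_asE.
rewrite mul_letterM ?reduced_mul_word//.
by case: eqP => // ->; rewrite mul_letter1.
Qed.

Lemma mul_word1 w : reduced w -> mul_word w [::] = w.
Proof.
elim: w => //= x w IH; rewrite reduced_cons => rxw; have /and3P[_ _ rw] := rxw.
by rewrite IH// mul_letter_cons// reduced_cons.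
Qed.

Lemma mul_inv_word w : reduced w -> mul_word (inv_word w) w = [::].
Proof.
elim: w => //= -[i g] w IH rxw; have := rxw; rewrite reduced_cons => /and3P[_ _ rw].
rewrite /inv_word /= rev_cons -cats1 /mul_word foldr_cat /=.
by rewrite -(mul_letter_cons rxw) mul_letterM// mulVg mul_letter1; exact: IH.
Qed.

Lemma inv_wordK w : inv_word (inv_word w) = w.
Proof.
rewrite /inv_word map_rev revK -map_comp map_id_in// => -[i g] _.
by rewrite /inv_letter /= invgK.
Qed.

Definition fp_one := @FreeProduct [::] isT.
Definition fp_mul (u v : free_product) := FreeProduct (reduced_mul_word u (word_reduced v)).
Definition fp_inv (u : free_product) := FreeProduct (reduced_inv_word (word_reduced u)).

Lemma fp_mulA : associative fp_mul.
Proof. by move=> u v w; apply/val_inj; rewrite /= mul_wordA// word_reduced. Qed.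

Lemma fp_mul1g : left_id fp_one fp_mul.
Proof. by move=> u; apply/val_inj. Qed.

Lemma fp_mulg1 : right_id fp_one fp_mul.
Proof. by move=> u; apply/val_inj; rewrite /= mul_word1// word_reduced. Qed.

Lemma fp_mulVg : left_inverse fp_one fp_inv fp_mul.
Proof. by move=> u; apply/val_inj; rewrite /= mul_inv_word// word_reduced. Qed.

Lemma fp_mulgV : right_inverse fp_one fp_inv fp_mul.
Proof.
by move=> u; rewrite -{1}[u](_ : fp_inv (fp_inv u) = u) ?fp_mulVg//;
  apply/val_inj; rewrite /= inv_wordK.
Qed.

HB.instance Definition _ :=
  isGroup.Build free_product fp_mulA fp_mul1g fp_mulg1 fp_mulVg fp_mulgV.

Definition fp_inj (i : I) (g : G i) : free_product :=
  FreeProduct (reduced_mul_letter (Tagged G g) (isT : reduced [::])).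

Lemma fp_injM i : {morph @fp_inj i : g h / g * h}.
Proof.
move=> g h; apply/val_inj; rewrite /= -(mul_letterM g h (isT : reduced [::])).
have [->|g1] := eqVneq g 1; first by rewrite !mul_letter1.
by rewrite [mul_letter (Tagged G g) [::]]mul_letter_cons// reduced_cons /= g1.
Qed.

(* Every element is the product of the letters of its reduced word. *)
Lemma fp_prodE (u : free_product) : u = \prod_(x <- word u) fp_inj (tagged x).
Proof.
apply/val_inj; case: u => u /=; elim: u => [|[i g] u IH] ru; first by rewrite big_nil.
have := ru; rewrite reduced_cons => /and3P[g1 _ /IH {}IH].
rewrite big_cons /= -IH [mul_letter _ [::]]mul_letter_cons /= ?mul_letter_cons//.
by rewrite reduced_cons g1.
Qed.

End FreeProduct.

Section L1Norm.
Context (R : realType) (I : choiceType) (G : I -> groupType).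
Context (N : forall i, group_norm R (G i)).
Implicit Types u v : free_product G.

Definition l1_word (w : seq (letter G)) : R := \sum_(x <- w) N (tag x) (tagged x).

Lemma l1_word_ge0 w : 0 <= l1_word w.
Proof. by apply: sumr_ge0 => x _; exact: gnorm_ge0. Qed.

Lemma l1_word_eq0 u : l1_word u = 0 <-> u = 1%g.
Proof.
split=> [|->]; last by rewrite /l1_word big_nil.
case: u => -[|x w] rw /=; first by move=> _; apply/val_inj.
have := rw; rewrite {1}reduced_cons => /and3P[/eqP x1 _ _].
rewrite /l1_word big_cons => /eqP; rewrite paddr_eq0 ?gnorm_ge0 ?l1_word_ge0//.
by case/andP => /eqP/gnorm_eq0.
Qed.

Lemma l1_mul_letter x w : l1_word (mul_letter x w) <= N (tag x) (tagged x) + l1_word w.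
Proof.
rewrite /mul_letter; case: eqP => _; first by rewrite lerDr gnorm_ge0.
case: w => [|[j k] w]; first by rewrite /l1_word big_cons.
case: x => i g /=; have [e|ne] := eqVneq j i; last by rewrite /l1_word big_cons.
subst j; rewrite tagged_asE {2}/l1_word big_cons /= -/(l1_word w) addrA.
case: eqP => _; first by rewrite lerDr addr_ge0 ?gnorm_ge0.
by rewrite /l1_word big_cons lerD2r /= gnormM.
Qed.

Lemma l1_mul u v : l1_word (u * v)%g <= l1_word u + l1_word v.
Proof.
rewrite /=; elim: (word u) => [|x w IH] /=; first by rewrite /l1_word big_nil add0r.
rewrite (le_trans (l1_mul_letter _ _))// {2}/l1_word big_cons -addrA lerD2l.
exact: IH.
Qed.

Lemma l1_inv u : l1_word (u^-1)%g = l1_word u.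
Proof.
rewrite /l1_word /= /inv_word (perm_big (map (@inv_letter _ G) u)) ?perm_rev//=.
by rewrite big_map; apply: eq_bigr => x _; exact: gnormV.
Qed.

Definition l1_norm : group_norm R (free_product G) :=
  GroupNorm (fun u => l1_word_ge0 u) l1_word_eq0 l1_mul l1_inv.

End L1Norm.

Record nonprincipal_ultrafilter (T : Type) := NonprincipalUltrafilter {
  ultra :> set_system T ;
  ultra_ultrafilter : UltraFilter ultra ;
  ultra_nonprincipal : forall x, ~ ultra [set x] }.
#[global] Existing Instance ultra_ultrafilter.

Record scaling_sequence (R : realType) (omega : nonprincipal_ultrafilter nat) :=
  ScalingSequence {
  scaling :> nat -> R ;
  scaling_gt0 : forall n, 0 < scaling n ;
  scaling_cvg : scaling n @[n --> ultra omega] --> +oo }.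

Section AsymptoticCone.
Context (R : realType) (G : groupType) (N : group_norm R G).
Context (omega : nonprincipal_ultrafilter nat) (s : scaling_sequence R omega).

Definition admissible : set (nat -> G) :=
  [set x | exists C : R, forall n, N (x n) / s n <= C].

Definition cone_dist (x y : admissible) : R :=
  lim ((gdist N (\val x n) (\val y n) / s n) @[n --> ultra omega]).

Lemma cvg_ultra_bounded (u : nat -> R) (C : R) : (forall n, 0 <= u n <= C) ->
  cvg (u n @[n --> ultra omega]).
Proof.
move=> uC; pose F : set_system R := u n @[n --> ultra omega].
have PF : ProperFilter F by exact: fmap_proper_filter.
have UF : UltraFilter F.
  split => // H PH FH; apply/seteqP; split => // A HA.
  have [//|FnA] := in_ultra_setVsetC (u @^-1` A) (ultra_ultrafilter omega).
  have HnA : H (~` A) by exact: FH.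
  have : H (A `&` ~` A) by exact: filterI.
  by rewrite setICr => /filter_not_empty.
have := @segment_compact R 0 C; rewrite compact_ultra => /(_ F UF) [].
  by apply: nearW => n /=; rewrite in_itv/=.
by move=> l [_ Fl]; apply/cvg_ex; exists l.
Qed.

Lemma cvg_cone_dist (x y : admissible) :
  gdist N (\val x n) (\val y n) / s n @[n --> ultra omega] --> cone_dist x y.
Proof.
have := set_valP x; have := set_valP y => -[D yD] [C xC].
apply: (@cvg_ultra_bounded _ (C + D)) => n; have sn := ltW (scaling_gt0 s n).
rewrite divr_ge0 ?gdist_ge0//= (le_trans _ (lerD (xC n) (yD n)))//.
by rewrite -mulrDl ler_wpM2r ?invr_ge0// gdist_le.
Qed.

Lemma cone_dist_ge0 x y : 0 <= cone_dist x y.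
Proof.
apply: limr_ge; first by apply: cvgP; exact: cvg_cone_dist.
by apply: nearW => n; rewrite divr_ge0 ?gdist_ge0// ltW// scaling_gt0.
Qed.

Lemma cone_distxx x : cone_dist x x = 0.
Proof.
rewrite /cone_dist (_ : (fun n => _) = cst 0) ?lim_cst//.
by apply/funext => n; rewrite gdistxx mul0r.
Qed.

Lemma cone_distC x y : cone_dist x y = cone_dist y x.
Proof. by rewrite /cone_dist; under eq_fun do rewrite gdistC. Qed.

Lemma cone_dist_triangle y x z : cone_dist x z <= cone_dist x y + cone_dist y z.
Proof.
have xy_yz : gdist N (\val x n) (\val y n) / s n + gdist N (\val y n) (\val z n) / s n
    @[n --> ultra omega] --> cone_dist x y + cone_dist y z.
  by apply: cvgD; exact: cvg_cone_dist.
rewrite -(cvg_lim (@Rhausdorff R) xy_yz); 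
apply: ler_lim; [by apply: cvgP; exact: cvg_cone_dist|exact: cvgP xy_yz|].
apply: nearW => n /=; rewrite -mulrDl ler_wpM2r ?gdist_triangle//.
by rewrite invr_ge0 ltW// scaling_gt0.
Qed.

Definition cone_rel : rel admissible := fun x y => cone_dist x y == 0.

Lemma cone_rel_refl : reflexive cone_rel.
Proof. by move=> x; rewrite /cone_rel cone_distxx. Qed.

Lemma cone_rel_sym : symmetric cone_rel.
Proof. by move=> x y; rewrite /cone_rel cone_distC. Qed.

Lemma cone_rel_trans : transitive cone_rel.
Proof.
move=> y x z /eqP xy /eqP yz; rewrite /cone_rel eq_le cone_dist_ge0 andbT.
by rewrite (le_trans (cone_dist_triangle y x z))// xy yz addr0.
Qed.

Canonical cone_equiv := EquivRel cone_rel cone_rel_refl cone_rel_sym cone_rel_trans.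

Definition asymptotic_cone : Type := {eq_quot cone_equiv}%qT.
HB.instance Definition _ := Choice.on asymptotic_cone.

Definition to_cone (x : admissible) : asymptotic_cone := (\pi_({eq_quot cone_equiv}) x)%qT.
Definition of_cone (a : asymptotic_cone) : admissible := repr (a : {eq_quot cone_equiv}%qT).

Definition cone_mdist (a b : asymptotic_cone) : R := cone_dist (of_cone a) (of_cone b).

Lemma of_coneK : cancel of_cone to_cone.
Proof. by move=> a; rewrite /to_cone /of_cone reprK. Qed.

Lemma to_cone_eq x y : to_cone x = to_cone y <-> cone_dist x y = 0.
Proof.
split=> [/eqP|xy]; first by rewrite /to_cone eqmodE => /eqP.
by apply/eqP; rewrite /to_cone eqmodE; apply/eqP.
Qed.

Lemma cone_mdistE x y : cone_mdist (to_cone x) (to_cone y) = cone_dist x y.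
Proof.
have e z : cone_dist (of_cone (to_cone z)) z = 0 by apply/to_cone_eq; rewrite of_coneK.
apply/eqP; rewrite eq_le /cone_mdist; apply/andP; split.
  rewrite (le_trans (cone_dist_triangle x _ _))// e add0r.
  by rewrite (le_trans (cone_dist_triangle y _ _))// (cone_distC y) e addr0.
rewrite (le_trans (cone_dist_triangle (of_cone (to_cone x)) _ _))// (cone_distC x) e add0r.
by rewrite (le_trans (cone_dist_triangle (of_cone (to_cone y)) _ _))// e addr0.
Qed.

Lemma cone_mdistxx a : cone_mdist a a = 0.
Proof. exact: cone_distxx. Qed.

Lemma cone_mdist_positivity a b : cone_mdist a b = 0 -> a = b.
Proof. by move=> /to_cone_eq; rewrite !of_coneK. Qed.

Lemma cone_mdistC a b : cone_mdist a b = cone_mdist b a.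
Proof. exact: cone_distC. Qed.

Lemma cone_mdist_triangle b a c : cone_mdist a c <= cone_mdist a b + cone_mdist b c.
Proof. exact: cone_dist_triangle. Qed.

HB.instance Definition _ := isMetric.Build R asymptotic_cone
  cone_mdistxx cone_mdist_positivity cone_mdistC cone_mdist_triangle.

End AsymptoticCone.

(* [H] is total on [X * R], but only its restriction to [X * [0, 1]] is constrained. *)
Definition homotopic (R : realType) (X Y : topologicalType) (f g : X -> Y) : Prop :=
  exists H : X * R -> Y,
    [/\ {within [set z | 0 <= z.2 <= 1], continuous H},
        forall x, H (x, 0) = f x & forall x, H (x, 1) = g x].

Definition contractible (R : realType) (X : topologicalType) : Prop :=
  exists x0 : X, homotopic R (@idfun X) (cst x0).

(* Main.v *)
(* Replacing the first letter [x] of a reduced word by [p x], and dropping it when [p x = 1], gives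
   a map on the free product with the same properties as the [p i]: it is 1-Lipschitz because, by
   right invariance, the distance of two words is computed after cancelling their longest common
   suffix. For an integer-valued norm [N] with such a map [P], iterating [P] for [t * N g] steps
   moves [g] to [1] as [t] runs from 0 to 1, and the points reached from [g] at time [t] and from
   [h] at time [u] are at distance at most [2 d(g, h) + |t - u| N g + 1]. The constant vanishes
   after rescaling, so that the asymptotic cone inherits a continuous contraction. *)
Require Import Defs.
From mathcomp Require Import all_boot all_order all_algebra.
From mathcomp Require Import all_classical all_reals topology normedtype.
From mathcomp Require Import lra.
Import Order.TTheory GRing.Theory Num.Theory.
Import numFieldNormedType.Exports.
Local Open Scope classical_set_scope.
Local Open Scope ring_scope.

Set Implicit Arguments.
Unset Strict Implicit.
Unset Printing Implicit Defensive.

(** The hypotheses on one factor, bundled so that the free product with its $\ell_1$-norm can be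
    shown to inherit all of them at once. *)
Record contracting_step (R : realType) (G : groupType) (N : group_norm R G)
    (P : G -> G) : Prop := ContractingStep {
  step_int : forall g, N g \is a Num.int ;
  step_lipschitz : forall g h, gdist N (P g) (P h) <= gdist N g h ;
  step_near : forall g, gdist N (P g) g <= 1 ;
  step_decr : forall g, g <> 1%g -> N (P g) < N g ;
  step_one : P 1%g = 1%g }.

(** * Iterating a contracting step in a single group *)

Section IteratedStep.
Context (R : realType) (G : groupType) (N : group_norm R G) (P : G -> G).
Context (stepP : contracting_step N P).
Implicit Types g h k : G.

Lemma gnorm1 : N 1%g = 0.
Proof. exact/gnorm_eq0. Qed.

Lemma gdistg1 g : gdist N g 1%g = N g.
Proof. by rewrite /gdist invg1 mulg1. Qed.

Lemma gdist_mulr g h k : gdist N (g * k)%g (h * k)%g = gdist N g h.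
Proof. by rewrite /gdist invgM mulgA mulgK. Qed.

Lemma gnorm_sub_le g h : N g - N h <= gdist N g h.
Proof. by rewrite lerBlDr -{1}[g](mulgVK h) gnormM. Qed.

Lemma int_lt_le1 (x y : R) : x \is a Num.int -> y \is a Num.int ->
  x < y -> x + 1 <= y.
Proof. by move=> /intrP[m ->] /intrP[n ->]; rewrite ltr_int -[1]/(1%:~R) -intrD ler_int lezD1. Qed.

Lemma step_norm1 g : g <> 1%g -> N (P g) + 1 <= N g.
Proof. by move=> g1; apply: int_lt_le1; [exact: (step_int stepP)..|exact: (step_decr stepP)]. Qed.

Lemma step_norm_le g : N (P g) <= N g.
Proof.
have [->|/eqP/(step_decr stepP)/ltW//] := eqVneq g 1%g.
by rewrite (step_one stepP).
Qed.

Lemma iter_norm_le (k : nat) g : N (iter k P g) <= N g.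
Proof. by elim: k => //= k; apply: le_trans; exact: step_norm_le. Qed.

Lemma iter_near (k : nat) g : gdist N (iter k P g) g <= k%:R.
Proof.
elim: k => [|k IH]; first by rewrite gdistxx.
rewrite (le_trans (gdist_triangle _ (iter k P g) _ _))// -natr1 addrC lerD//.
exact: (step_near stepP).
Qed.

Lemma iter_lipschitz (k : nat) g h : gdist N (iter k P g) (iter k P h) <= gdist N g h.
Proof. by elim: k => //= k; apply: le_trans; exact: (step_lipschitz stepP). Qed.

(** The common number of steps is applied last and does not increase distances; each surplus step
    moves its point by at most 1. *)
Lemma iter_dist (k l : nat) g h :
  gdist N (iter k P g) (iter l P h) <= gdist N g h + `|k%:R - l%:R|.
Proof.
wlog lk : k l g h / (l <= k)%N.
  move=> H; have [/H//|/ltnW kl] := leqP l k.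
  by rewrite gdistC distrC (gdistC N g); exact: H.
rewrite -{1}(subnKC lk) iterD (le_trans (iter_lipschitz _ _ _))//.
rewrite (le_trans (gdist_triangle _ g _ _))// addrC lerD2l.
by rewrite -natrB// ger0_norm// iter_near.
Qed.

(** By integrality each step away from [1] lowers the norm by at least 1, and [1] is fixed. *)
Lemma iter_eq1 (k : nat) g : N g <= k%:R -> iter k P g = 1%g.
Proof.
elim: k g => [|k IH] g.
  by move=> g0; apply/(gnorm_eq0 N)/eqP; rewrite eq_le g0 gnorm_ge0.
rewrite iterSr -natr1 => gk; apply: IH.
have [->|/eqP/step_norm1] := eqVneq g 1%g; first by rewrite (step_one stepP) gnorm1.
by move=> /le_trans/(_ gk); rewrite lerD2r.
Qed.

(** Both truncations err downwards by less than 1, so the errors partly cancel and the loss is 1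
    rather than 2. *)
Lemma truncn_dist (a b : R) : 0 <= a -> 0 <= b ->
  `|(Num.truncn a)%:R - (Num.truncn b)%:R| <= `|a - b| + 1 :> R.
Proof.
move=> /truncn_itv + /truncn_itv; rewrite -!natr1 => /andP[a1 a2] /andP[b1 b2].
have := ler_norm (a - b); have := ler_norm (b - a); rewrite (distrC b) => ? ?.
by rewrite ler_norml; apply/andP; split; lra.
Qed.

(* At time [t] the point [g] has been pushed for [t * N g] steps: the number of steps depends on
   [g] so that every point reaches [1] at time [1], although the norm is unbounded. *)
Definition slide (t : R) g := iter (Num.truncn (t * N g)) P g.

Lemma slide0 g : slide 0 g = g.
Proof. by rewrite /slide mul0r truncn0. Qed.

Lemma slide1 g : slide 1 g = 1%g.
Proof.
rewrite /slide mul1r; apply: iter_eq1.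
(* As [N g] is a natural number, truncation at time 1 loses no step. *)
by have := step_int stepP g; rewrite intrEge0 ?gnorm_ge0// natrEtruncn => /eqP ->.
Qed.

(** One copy of [gdist N g h] comes from the Lipschitz bound, the other from the different step
    counts of [g] and [h]; the final 1 is the rounding error. *)
Lemma slide_dist (t u : R) g h : 0 <= t -> 0 <= u <= 1 ->
  gdist N (slide t g) (slide u h) <= gdist N g h * 2 + `|t - u| * N g + 1.
Proof.
move=> t0 /andP[u0 u1]; rewrite (le_trans (iter_dist _ _ _ _))//.
rewrite mulr_natr mulr2n -!addrA lerD2l (le_trans (truncn_dist _ _))//; last first.
  rewrite addrA lerD2r (_ : _ - _ = (t - u) * N g + u * (N g - N h)); last by lra.
  rewrite (le_trans (ler_normD _ _))// addrC !normrM !(ger0_norm u0) (ger0_norm (gnorm_ge0 _ _)).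
  rewrite lerD2l (le_trans (ler_piMl _ u1))// ler_norml gnorm_sub_le andbT.
  by rewrite lerNl opprB gdistC gnorm_sub_le.
all: by rewrite mulr_ge0 ?gnorm_ge0.
Qed.

(** * The induced contraction of the asymptotic cone *)

Context (omega : nonprincipal_ultrafilter nat) (s : scaling_sequence R omega).
Local Notation cone := (asymptotic_cone N s).

Lemma slide_admissible t (x : admissible N s) :
  admissible N s (fun n => slide t (\val x n)).
Proof.
have [C xC] := set_valP x; exists C => n; rewrite (le_trans _ (xC n))//.
by rewrite ler_wpM2r ?iter_norm_le// invr_ge0 ltW// scaling_gt0.
Qed.

Definition admissible_slide t (x : admissible N s) : admissible N s :=
  exist (fun z => z \in admissible N s) _ (mem_set (slide_admissible t x)).

Lemma admissible1 : admissible N s (fun=> 1%g).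
Proof. by exists 0 => n; rewrite gnorm1 mul0r. Qed.

Definition admissible_one : admissible N s :=
  exist (fun z => z \in admissible N s) _ (mem_set admissible1).

(** For times in $[0,1]$ the choice of representative is immaterial: [cone_slide_dist] with equal
    times bounds the distance of the results by twice that of the representatives. *)
Definition cone_slide (z : cone * R) : cone := to_cone (admissible_slide z.2 (of_cone z.1)).

Lemma cvg_inv_scaling : (scaling s n)^-1 @[n --> ultra omega] --> (0 : R).
Proof.
apply/gtr0_cvgV0; last exact: scaling_cvg.
by apply: nearW => n; exact: scaling_gt0.
Qed.

(** This is [slide_dist] divided by [s n]: the additive 1 becomes [(s n)^-1], which tends to 0, and
    [N] is read as the distance to [1]. *)
Lemma cone_slide_dist t u (x y : admissible N s) : 0 <= t -> 0 <= u <= 1 ->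
  cone_dist (admissible_slide t x) (admissible_slide u y) <=
  cone_dist x y * 2 + `|t - u| * cone_dist x admissible_one.
Proof.
move=> t0 u01.
have lim_bound : gdist N (\val x n) (\val y n) / s n * 2 +
    `|t - u| * (gdist N (\val x n) (\val admissible_one n) / s n) + (s n)^-1
    @[n --> ultra omega] -->
    cone_dist x y * 2 + `|t - u| * cone_dist x admissible_one + 0.
  apply: cvgD; last exact: cvg_inv_scaling.
  by apply: cvgD; [apply: cvgMl|apply: cvgMr]; exact: cvg_cone_dist.
rewrite -[leRHS]addr0 -(cvg_lim (@Rhausdorff R) lim_bound).
apply: ler_lim; [by apply: cvgP; exact: cvg_cone_dist|exact: cvgP lim_bound|].
apply: nearW => n; rewrite /= gdistg1 -[X in _ <= _ + X]mul1r mulrAC mulrA -!mulrDl.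
by rewrite ler_wpM2r ?slide_dist// invr_ge0 ltW// scaling_gt0.
Qed.

Lemma cone_slide_continuous : {within [set z | 0 <= z.2 <= 1], continuous cone_slide}.
Proof.
apply/subspace_continuousP => -[a t] /= /andP[t0 t1].
apply/cvg_ballP => e e0.
set C := cone_dist (of_cone a) admissible_one.
have C0 : 0 <= C := cone_dist_ge0 _ _.
have C2 : 0 < 2 * (C + 1) by lra.
rewrite near_withinE /=.
(* Each of the two terms of [cone_slide_dist] stays below [e / 2]; [C + 1] replaces [C], which may
   be 0. *)
exists (ball a (e / 4), ball t (e / (2 * (C + 1)))) => /=.
  by split; apply: nbhsx_ballx; rewrite divr_gt0.
move=> [b u] /= [ab tu] u01.
rewrite ballEmdist /= /cone_slide /=.
change (cone_mdist (to_cone (admissible_slide t (of_cone a)))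
  (to_cone (admissible_slide u (of_cone b))) < e).
rewrite cone_mdistE (le_lt_trans (cone_slide_dist _ _ t0 u01))//.
have {}ab : cone_dist (of_cone a) (of_cone b) < e / 4 by move: ab; rewrite ballEmdist.
move: tu; rewrite /ball /= ltr_pdivlMr// => tu.
have := normr_ge0 (t - u); rewrite -/C; nra.
Qed.

Lemma contractible_cone : contractible R cone.
Proof.
exists (to_cone admissible_one), cone_slide; split; first exact: cone_slide_continuous.
- move=> a; rewrite -[RHS]of_coneK /cone_slide /=; congr to_cone.
  by apply/val_inj/funext => n /=; exact: slide0.
- move=> a; rewrite /cone_slide /=; congr to_cone.
  by apply/val_inj/funext => n /=; exact: slide1.
Qed.

End IteratedStep.

(** * Words and the elements of the free product they represent *)

Section FreeProductWords.
Context (I : choiceType) (G : I -> groupType).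
Implicit Types (x y : letter G) (w a b : seq (letter G)).

Lemma reduced_cat_cons a x b :
  reduced (a ++ x :: b) = reduced (rcons a x) && reduced (x :: b).
Proof.
rewrite /reduced sorted_cat_cons all_cat all_rcons /=.
by case: (_ != _); rewrite ?andbF //= -!andbA; do !bool_congr.
Qed.

(** The condition on neighbouring letters sees only their factors. *)
Lemma reduced_rcons_tagged a i (g h : G i) : h != 1%g ->
  reduced (rcons a (Tagged G g)) -> reduced (rcons a (Tagged G h)).
Proof.
move=> h1; rewrite /reduced !all_rcons /= h1 => /andP[/andP[_ ->]] /=.
have sorted_tag k : sorted (fun x y => tag x != tag y) (rcons a k) =
    sorted (fun i j => i != j) (rcons (map tag a) (tag k)).
  by rewrite -map_rcons sorted_map.
by rewrite !sorted_tag.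
Qed.

Lemma reduced_cons_tagged i (g h : G i) b : h != 1%g ->
  reduced (Tagged G g :: b) -> reduced (Tagged G h :: b).
Proof. by move=> h1; rewrite !reduced_cons /= h1 => /and3P[_ -> ->]. Qed.

Lemma reduced_catr a b : reduced (a ++ b) -> reduced b.
Proof. by rewrite /reduced all_cat => /andP[/andP[_ ->]] /cat_sorted2[_ ->]. Qed.

Lemma reduced_catl a b : reduced (a ++ b) -> reduced a.
Proof. by rewrite /reduced all_cat => /andP[/andP[-> _]] /cat_sorted2[-> _]. Qed.

Lemma inv_word_rcons a x : inv_word (rcons a x) = inv_letter x :: inv_word a.
Proof. by rewrite /inv_word map_rcons rev_rcons. Qed.

(** Evaluation of arbitrary words, reduced or not; being multiplicative under concatenation, it
    turns computations with words into group algebra. *)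
Definition fp_word w : free_product G := (\prod_(x <- w) fp_inj (tagged x))%g.

Lemma fp_wordK w : reduced w -> word (fp_word w) = w.
Proof. by move=> rw; rewrite /fp_word -(fp_prodE (FreeProduct rw)). Qed.

Lemma wordK (u : free_product G) : fp_word (word u) = u.
Proof. by rewrite /fp_word -fp_prodE. Qed.

Lemma fp_word_cons x w : fp_word (x :: w) = (fp_inj (tagged x) * fp_word w)%g.
Proof. by rewrite /fp_word big_cons. Qed.

Lemma fp_word_cat a b : fp_word (a ++ b) = (fp_word a * fp_word b)%g.
Proof. by rewrite /fp_word big_cat. Qed.

Lemma fp_word_rcons a x : fp_word (rcons a x) = (fp_word a * fp_inj (tagged x))%g.
Proof. by rewrite -cats1 fp_word_cat fp_word_cons /fp_word big_nil mulg1. Qed.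

Lemma fp_word_inv w : reduced w -> fp_word (inv_word w) = (fp_word w)^-1%g.
Proof.
by move=> rw; apply/val_inj; rewrite /= !fp_wordK// reduced_inv_word.
Qed.

Lemma fp_inj1 i : fp_inj (1%g : G i) = 1%g.
Proof. by apply/val_inj; rewrite /= mul_letter1. Qed.

Lemma fp_injV i (g : G i) : fp_inj g^-1%g = (fp_inj g)^-1%g.
Proof. by apply: (mulgI (fp_inj g)); rewrite -fp_injM !mulgV fp_inj1. Qed.

End FreeProductWords.

Lemma common_suffix (T : eqType) (u v : seq T) : exists a b w,
  [/\ u = a ++ w, v = b ++ w & [\/ a = [::], b = [::] |
    exists a' x b' y, [/\ a = rcons a' x, b = rcons b' y & x != y]]].
Proof.
elim/last_ind: u v => [|u x IH] v.
  by exists [::], v, [::]; rewrite ?cats0; split=> //; constructor 1.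
case/lastP: v => [|v y].
  by exists (rcons u x), [::], [::]; rewrite cats0; split=> //; constructor 2.
have [<-{y}|xy] := eqVneq x y.
  have [a [b [w [-> -> ab]]]] := IH v.
  by exists a, b, (rcons w x); rewrite !rcons_cat.
exists (rcons u x), (rcons v y), [::]; rewrite !cats0; split=> //; constructor 3.
by exists u, x, v, y.
Qed.

(** * The step on the free product *)

Section FreeProductStep.
Context (R : realType) (I : choiceType) (G : I -> groupType).
Context (N : forall i, group_norm R (G i)) (p : forall i, G i -> G i).
Context (pP : forall i, contracting_step (N i) (@p i)).
Implicit Types (x y : letter G) (w a b : seq (letter G)) (u v : free_product G).
Local Notation NG := (l1_norm N).

Lemma l1_word_cons x w : l1_word N (x :: w) = N (tag x) (tagged x) + l1_word N w.
Proof. by rewrite /l1_word big_cons. Qed.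

Lemma l1_word_cat a b : l1_word N (a ++ b) = l1_word N a + l1_word N b.
Proof. by rewrite /l1_word big_cat. Qed.

Lemma l1_word_rcons a x : l1_word N (rcons a x) = l1_word N a + N (tag x) (tagged x).
Proof. by rewrite -cats1 l1_word_cat l1_word_cons /l1_word big_nil addr0. Qed.

Lemma l1_word_inv w : l1_word N (inv_word w) = l1_word N w.
Proof.
rewrite /l1_word /inv_word (perm_big (map (@inv_letter _ G) w)) ?perm_rev//=.
by rewrite big_map; apply: eq_bigr => x _; exact: gnormV.
Qed.

Lemma l1_norm_inj i (g : G i) : NG (fp_inj g) = N i g.
Proof.
have [->|g1] := eqVneq g 1%g; first by rewrite fp_inj1 !gnorm1.
by rewrite /= /mul_letter (negPf g1) /l1_word big_seq1.
Qed.

Lemma gdist_inj i (g h : G i) : gdist NG (fp_inj g) (fp_inj h) = gdist (N i) g h.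
Proof. by rewrite /gdist -fp_injV -fp_injM l1_norm_inj. Qed.

Lemma l1_norm_word w : reduced w -> NG (fp_word w) = l1_word N w.
Proof. by move=> rw; rewrite /= fp_wordK. Qed.

Lemma l1_word_int w : l1_word N w \is a Num.int.
Proof. by apply: rpred_sum => x _; exact: (step_int (pP _)). Qed.

Definition step_word w :=
  if w is x :: w' then
    if p (tagged x) == 1%g then w' else Tagged G (p (tagged x)) :: w'
  else [::].

Lemma reduced_step_word w : reduced w -> reduced (step_word w).
Proof.
case: w => // -[i g] w /= rw; case: eqP => [_|/eqP p1].
  by move: rw; rewrite reduced_cons => /and3P[].
exact: reduced_cons_tagged rw.
Qed.

Definition fp_step u := FreeProduct (reduced_step_word (word_reduced u)).

Lemma fp_stepE u : fp_step u = fp_word (step_word (word u)).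
Proof. by rewrite -[LHS]wordK. Qed.

(** In the group, dropping a letter is multiplying by the image of [1], so the two cases of
    [step_word] merge. *)
Lemma fp_word_step_cons x w :
  fp_word (step_word (x :: w)) = (fp_inj (p (tagged x)) * fp_word w)%g.
Proof.
rewrite /=; case: eqP => [->|_]; last by rewrite fp_word_cons.
by rewrite fp_inj1 mul1g.
Qed.

Lemma fp_word_step_cat a w : a != [::] ->
  fp_word (step_word (a ++ w)) = (fp_word (step_word a) * fp_word w)%g.
Proof.
by case: a => // x a _; rewrite cat_cons !fp_word_step_cons fp_word_cat mulgA.
Qed.

(** The boolean records the unit of norm gained when there is a first letter to act on; the
    Lipschitz estimates spend this unit. *)
Lemma l1_step_word w : reduced w ->
  l1_word N (step_word w) + (w != [::])%:R <= l1_word N w.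
Proof.
case: w => [|x w]; first by rewrite /= addr0.
rewrite reduced_cons => /and3P[/eqP x1 _ _] /=.
have := step_norm1 (pP _) x1; case: eqP => [px|_] px1; last first.
  by rewrite !l1_word_cons /= addrAC lerD2r.
by rewrite l1_word_cons addrC lerD2r (le_trans _ px1)// lerDr gnorm_ge0.
Qed.

Lemma fp_step_near u : gdist NG (fp_step u) u <= 1.
Proof.
rewrite -{2}[u]wordK fp_stepE; case: (word u) => [|x w]; first by rewrite gdistxx.
rewrite fp_word_step_cons fp_word_cons gdist_mulr gdist_inj.
exact: (step_near (pP _)).
Qed.

Lemma fp_step_decr u : u <> 1%g -> NG (fp_step u) < NG u.
Proof.
move=> u1; have := l1_step_word (word_reduced u).
have -> : word u != [::] by apply/eqP => u0; apply: u1; exact/val_inj.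
by apply: lt_le_trans; rewrite ltrDl.
Qed.

Lemma gdist_inj_neq x y : tagged x != 1%g -> tagged y != 1%g -> tag x != tag y ->
  gdist NG (fp_inj (tagged x)) (fp_inj (tagged y)) =
  N (tag x) (tagged x) + N (tag y) (tagged y).
Proof.
move=> x1 y1 xy; have -> : gdist NG (fp_inj (tagged x)) (fp_inj (tagged y)) =
    NG (fp_word [:: x; inv_letter y]).
  by rewrite /gdist -fp_injV !fp_word_cons /fp_word big_nil mulg1.
rewrite l1_norm_word ?l1_word_cons ?gnormV; last first.
  by rewrite /reduced /= invg_eq1 x1 y1 xy.
by rewrite /l1_word big_nil addr0.
Qed.

(** Cancellation stops at the distinct last letters: $xy^{-1}$ is one non-trivial letter if the
    factors agree, and two letters otherwise, so $a\,x\,y^{-1}b^{-1}$ loses no further norm. *)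
Lemma gdist_rcons a x b y : reduced (rcons a x) -> reduced (rcons b y) -> x != y ->
  gdist NG (fp_word (rcons a x)) (fp_word (rcons b y)) =
  l1_word N a + gdist NG (fp_inj (tagged x)) (fp_inj (tagged y)) + l1_word N b.
Proof.
move=> rx ry xy.
have rby : reduced (inv_letter y :: inv_word b) by rewrite -inv_word_rcons reduced_inv_word.
rewrite {1}/gdist -fp_word_inv// -fp_word_cat inv_word_rcons.
case: x y xy rx ry rby => i g [j h] xy rx ry rby.
have [ij|ij] := eqVneq i j.
  subst j; rewrite (gdist_inj g h) /gdist.
  have gh1 : (g * h^-1)%g != 1%g.
    by apply: contraNneq xy => /(canRL (mulgVK _)); rewrite mul1g => ->.
  have -> : fp_word (rcons a (Tagged G g) ++ inv_letter (Tagged G h) :: inv_word b) =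
      fp_word (a ++ Tagged G (g * h^-1)%g :: inv_word b).
    by rewrite !fp_word_cat fp_word_rcons !fp_word_cons fp_injM !mulgA.
  rewrite l1_norm_word.
    by rewrite l1_word_cat l1_word_cons l1_word_inv addrA.
  rewrite reduced_cat_cons (reduced_rcons_tagged gh1 rx)/=.
  exact: reduced_cons_tagged rby.
have [x1 y1] : g != 1%g /\ h != 1%g.
  by split; [case/andP: rx|case/andP: ry]; rewrite all_rcons => /andP[].
rewrite (@gdist_inj_neq (Tagged G g) (Tagged G h))//.
rewrite l1_norm_word; last first.
  by rewrite cat_rcons reduced_cat_cons rx reduced_cons rby x1 /= ij.
by rewrite l1_word_cat l1_word_rcons l1_word_cons /= gnormV l1_word_inv !addrA.
Qed.

Lemma fp_word_step_rcons a x : fp_word (step_word (rcons a x)) =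
  (fp_word (step_word a) *
   fp_inj (if a == [::] then p (tagged x) else tagged x))%g.
Proof.
case: eqP => [->|/eqP a0].
  by rewrite fp_word_step_cons /fp_word !big_nil mulg1 mul1g.
by rewrite -cats1 fp_word_step_cat// fp_word_cons {2}/fp_word big_nil mulg1.
Qed.

Lemma gdist_step_inj x y : tagged x != 1%g -> tagged y != 1%g ->
  gdist NG (fp_inj (p (tagged x))) (fp_inj (p (tagged y))) <=
  gdist NG (fp_inj (tagged x)) (fp_inj (tagged y)).
Proof.
case: x y => i g [j h] g1 h1; have [ij|ij] := eqVneq i j.
  by subst j; rewrite !gdist_inj; exact: (step_lipschitz (pP _)).
rewrite (@gdist_inj_neq (Tagged G g) (Tagged G h))//.
rewrite (le_trans (gdist_le _ _ _))// !l1_norm_inj; apply: lerD; exact: step_norm_le.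
Qed.

(** The step reaches [x] only if [a] is empty, and [y] only if [b] is. If it changes just one of
    them, their distance grows by at most 1, which the norm lost by the other, non-empty prefix pays
    for. *)
Lemma gdist_step_rcons a x b y :
    reduced (rcons a x) -> reduced (rcons b y) -> x != y ->
  gdist NG (fp_word (step_word (rcons a x))) (fp_word (step_word (rcons b y))) <=
  gdist NG (fp_word (rcons a x)) (fp_word (rcons b y)).
Proof.
move=> rx ry xy; rewrite gdist_rcons// !fp_word_step_rcons.
have [ra rb] : reduced a /\ reduced b.
  by move: rx ry; rewrite -!cats1 => /reduced_catl ? /reduced_catl.
have [x1 y1] : tagged x != 1%g /\ tagged y != 1%g.
  by split; [case/andP: rx|case/andP: ry]; rewrite all_rcons => /andP[].
have p_near (z : letter G) : gdist NG (fp_inj (p (tagged z))) (fp_inj (tagged z)) <= 1.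
  by rewrite gdist_inj; exact: (step_near (pP _)).
set x' := fp_inj (if a == _ then _ else _); set y' := fp_inj (if b == _ then _ else _).
have xy' : gdist NG x' y' <= (a != [::])%:R + gdist NG (fp_inj (tagged x)) (fp_inj (tagged y)) +
    (b != [::])%:R.
  rewrite /x' /y'; case: eqP => _; case: eqP => _; rewrite ?[~~ true]/= ?[~~ false]/= ?addr0 ?add0r.
  - exact: gdist_step_inj.
  - by rewrite addrC (le_trans (gdist_triangle _ (fp_inj (tagged x)) _ _))// lerD2r.
  - by rewrite (le_trans (gdist_triangle _ (fp_inj (tagged y)) _ _))// addrC lerD2r gdistC.
  - by rewrite addrAC lerDr addr_ge0.
have := l1_step_word ra; have := l1_step_word rb.
rewrite -!(l1_norm_word (reduced_step_word _))// => lb la.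
(* By right invariance, stripping the stepped prefix in front of [x'] costs exactly its norm; the
   same is then done for [y']. *)
rewrite (le_trans (gdist_triangle _ x' _ _))//.
rewrite {1}/gdist mulgK.
rewrite (le_trans (lerD (lexx _) (gdist_triangle _ y' _ _)))//.
rewrite [gdist _ y' _]gdistC {2}/gdist mulgK.
move: xy' la lb; lra.
Qed.

(** In [b ++ w] the step acts inside the non-empty [b] and shortens it by at least 1; this offsets
    the move of [w] itself, which is at most 1. *)
Lemma gdist_step_suffix b w : reduced (b ++ w) ->
  gdist NG (fp_word (step_word w)) (fp_word (step_word (b ++ w))) <=
  gdist NG (fp_word w) (fp_word (b ++ w)).
Proof.
have [->|b0] := eqVneq b [::]; first by rewrite !gdistxx.
move=> rbw; have [rb rw] := (reduced_catl rbw, reduced_catr rbw).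
have -> : gdist NG (fp_word w) (fp_word (b ++ w)) = l1_word N b.
  by rewrite gdistC fp_word_cat /gdist mulgK l1_norm_word.
rewrite (le_trans _ (l1_step_word rb))// b0 addrC.
rewrite (le_trans (gdist_triangle _ (fp_word w) _ _))// lerD//.
  by have := fp_step_near (fp_word w); rewrite fp_stepE fp_wordK.
by rewrite gdistC fp_word_step_cat// /gdist mulgK l1_norm_word// reduced_step_word.
Qed.

Lemma fp_step_lipschitz u v : gdist NG (fp_step u) (fp_step v) <= gdist NG u v.
Proof.
rewrite -[in leRHS](wordK u) -[in leRHS](wordK v) !fp_stepE.
have := word_reduced u; have := word_reduced v.
have [a [b [w [-> -> [->|->|abP]]]]] := common_suffix (word u) (word v) => rv ru.
- exact: gdist_step_suffix.
- by rewrite gdistC [leRHS]gdistC; exact: gdist_step_suffix.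
have [a' [x [b' [y [ea eb xy]]]]] := abP.
have [a0 b0] : a != [::] /\ b != [::] by rewrite ea eb; split; case: (a') (b') => [|??] [|??].
(* Both prefixes are non-empty, so neither step touches the common suffix, which cancels by right
   invariance. *)
rewrite !fp_word_step_cat// !fp_word_cat !gdist_mulr ea eb.
by apply: gdist_step_rcons; rewrite // -?ea -?eb; [exact: reduced_catl ru|exact: reduced_catl rv].
Qed.

Lemma contracting_step_free_product : contracting_step NG fp_step.
Proof.
split; [|exact: fp_step_lipschitz|exact: fp_step_near|exact: fp_step_decr|].
- by move=> u; exact: l1_word_int.
- exact/val_inj.
Qed.

End FreeProductStep.

Theorem proposition4p21 (R : realType) (I : choiceType) (G : I -> groupType)
    (N : forall i, group_norm R (G i)) (p : forall i, G i -> G i)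
    (N_int : forall i (g : G i), N i g \is a Num.int)
    (p_lipschitz : forall i (g h : G i), gdist (N i) (p i g) (p i h) <= gdist (N i) g h)
    (p_near : forall i (g : G i), gdist (N i) (p i g) g <= 1)
    (p_decr : forall i (g : G i), g <> 1%g -> N i (p i g) < N i g)
    (p_one : forall i, p i 1%g = 1%g)
    (omega : nonprincipal_ultrafilter nat) (s : scaling_sequence R omega) :
  contractible R (asymptotic_cone (l1_norm N) s).
Proof.
exact: (contractible_cone (contracting_step_free_product
  (fun i => ContractingStep (N_int i) (p_lipschitz i) (p_near i) (p_decr i) (p_one i)))).
Qed.
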